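(* Let $K$ be $\mathbb{R}$ or $\mathbb{C}$ and let $X$ be a finite-dimensional vector space over $K$ with norm $\|\cdot\|$. Then $X$ with norm $\|\cdot\|$ is isometrically isomorphic to the multiplicative normed space $e^X$ with norm $\|u\|_* = \exp\|\log u\|$, under the mapping $\phi=\exp: X\to e^X$ and with $\alpha = \exp: K\to e^K$; i.e., $\exp$ is an isomorphism of $X$ onto $e^X$ and $\exp\|x\| = \|\exp x\|_*$ for each $x\in X$ (equivalently, $\log\|v\|_* = \|\log v\|$ for each $v\in e^X$).
   Context: $e^{\mathbb{C}} = \{(r,\theta): r>0,\ \theta\in\mathbb{R}\}$; $\exp:\mathbb{C}\to e^{\mathbb{C}}$, $\exp(a+ib)=(e^a,b)$, is a bijection with inverse $\log(r,\theta)=\ln r+i\theta$. $e^{\mathbb{R}}$ is the set of positive reals, identified with $\{(r,0)\}\subset e^{\mathbb{C}}$. Multiplication is $(r_1,\theta_1)(r_2,\theta_2)=(r_1r_2,\theta_1+\theta_2)$ and $z^w=\exp(w\log z)$ for $z \in e^K$, $w\in K$. $e^K$ is a field with ''addition'' $(a,b)\mapsto ab$ and ''multiplication'' $(a,b)\mapsto a^{\log b}=\exp(\log a\log b)$, i.e. the arithmetic of $e^K$ is generated from that of $K$ by $\exp$. Fixing a basis, $X$ is identified with $K^n$, and $\exp x = (\exp x_1,\dots,\exp x_n)$ componentwise, $e^X = \{\exp x: x\in X\}$, with $\log$ its componentwise inverse. $e^X$ is a vector space over $e^K$ with vector addition $u\oplus v = (u_1v_1,\dots,u_nv_n)$ and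 scalar multiplication $a\otimes u = (u_1^{\log a},\dots,u_n^{\log a})$, $a\in e^K$. A multiplicative norm on $e^X$ is a function $\|\cdot\|_*$ with values in $e^{\mathbb{R}}$ satisfying, for all $u, v \in e^X$ and $\alpha\in K$: $\|u\|_*\ge 1$ with equality iff $u=1$ (the vector of all ones), $\|u^\alpha\|_* = \|u\|_*^{|\alpha|}$, and $\|uv\|_*\le\|u\|_*\|v\|_*$. Definition of isometrically isomorphic: let $X$, $Y$ be normed spaces over fields $K$, $L$ with norms $\|\cdot\|_X:X\to K$, $\|\cdot\|_Y:Y\to L$, where the arithmetic of $L$ is generated from that of $K$ by $\alpha:K\to L$. $X$ and $Y$ are isometrically isomorphic if there is an isomorphism $\phi:X\to Y$ (respecting vector addition, and scalar multiplication with scalars identified through $\alpha$) with $\alpha(\|x\|_X)=\|\phi(x)\|_Y$ for every $x\in X$. *)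

(* Defs.v *)
From HB Require Import structures.
From mathcomp Require Import all_boot all_order all_algebra.
From mathcomp Require Import complex.
From mathcomp Require Import all_classical all_reals all_analysis.
Set Implicit Arguments.
Unset Strict Implicit.
Unset Printing Implicit Defensive.
Import Order.TTheory GRing.Theory Num.Theory.
Import numFieldNormedType.Exports.
Local Open Scope ring_scope.

#[short(type="finNormedModType")]
HB.structure Definition FinNormedModule (K : numFieldType) :=
  {V of NormedModule K V & Vector K V}.

(* The set e^R of positive reals. *)
Record epos (R : realType) := Epos {epos_val : R; _ : 0 < epos_val}.

HB.instance Definition _ (R : realType) := [isSub of epos R for @epos_val R].
HB.instance Definition _ (R : realType) := [Choice of epos R by <:].

(* The set e^C of pairs (r, theta) with r > 0; theta is not taken modulo
   2 pi, so that exp : C -> e^C is a bijection. *)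
Record epolar (R : realType) := Epolar {epolar_val : R * R; _ : 0 < epolar_val.1}.

HB.instance Definition _ (R : realType) :=
  [isSub of epolar R for @epolar_val R].
HB.instance Definition _ (R : realType) := [Choice of epolar R by <:].

Section ExpReal.
Variable R : realType.
Implicit Types (x : R) (u v w : epos R).

Lemma eposP u : 0 < epos_val u. Proof. by case: u. Qed.

Definition exp_real x : epos R := Epos (expR_gt0 x).
Definition log_real u : R := ln (epos_val u).
Definition one_real : epos R := Epos (@ltr01 R).
Definition mul_real u v : epos R := Epos (mulr_gt0 (eposP u) (eposP v)).
Definition times_real u v : epos R := exp_real (log_real u * log_real v).
Definition opp_real u : epos R := exp_real (- log_real u).
Definition inv_real u : epos R := exp_real (log_real u)^-1.

Lemma exp_realK : cancel exp_real log_real.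
Proof. by move=> x; rewrite /log_real expRK. Qed.

Lemma log_realK : cancel log_real exp_real.
Proof. by move=> u; apply: val_inj; rewrite /= lnK // posrE eposP. Qed.

Lemma log_real1 : log_real one_real = 0. Proof. exact: ln1. Qed.

Lemma log_realM u v : log_real (mul_real u v) = log_real u + log_real v.
Proof. by rewrite /log_real lnM // posrE eposP. Qed.

Let logE := (log_realM, log_real1, exp_realK).

Fact mul_realA : associative mul_real.
Proof. by move=> u v w; apply: (can_inj log_realK); rewrite !logE addrA. Qed.
Fact mul_realC : commutative mul_real.
Proof. by move=> u v; apply: (can_inj log_realK); rewrite !logE addrC. Qed.
Fact mul_1real : left_id one_real mul_real.
Proof. by move=> u; apply: (can_inj log_realK); rewrite !logE add0r. Qed.
Fact mul_Vreal : left_inverse one_real opp_real mul_real.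
Proof. by move=> u; apply: (can_inj log_realK); rewrite !logE addNr. Qed.

Fact times_realA : associative times_real.
Proof. by move=> u v w; rewrite /times_real !logE mulrA. Qed.
Fact times_realC : commutative times_real.
Proof. by move=> u v; rewrite /times_real mulrC. Qed.
Fact times_1real : left_id (exp_real 1) times_real.
Proof. by move=> u; rewrite /times_real !logE mul1r log_realK. Qed.
Fact times_realDl : left_distributive times_real mul_real.
Proof.
by move=> u v w; apply: (can_inj log_realK); rewrite !logE mulrDl.
Qed.
Fact exp_real1_neq : exp_real 1 != one_real.
Proof.
apply/eqP => /(congr1 log_real); rewrite !logE => /eqP.
by rewrite oner_eq0.
Qed.
Fact times_Vreal u : u != one_real -> times_real (inv_real u) u = exp_real 1.
Proof.
move=> u1; rewrite /times_real !logE mulVf //.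
by apply: contra u1 => /eqP lu; rewrite -(log_realK u) lu -log_real1 log_realK.
Qed.
Fact inv_real1 : inv_real one_real = one_real.
Proof. by apply: (can_inj log_realK); rewrite !logE invr0. Qed.

End ExpReal.

(* The field e^R: its addition is the ordinary product of positive reals, its
   multiplication is (a, b) |-> exp (log a * log b), its zero is the number 1
   and its one is exp 1. *)
HB.instance Definition _ (R : realType) := GRing.isZmodule.Build (epos R)
  (@mul_realA R) (@mul_realC R) (@mul_1real R) (@mul_Vreal R).
HB.instance Definition _ (R : realType) :=
  GRing.Zmodule_isComNzRing.Build (epos R)
    (@times_realA R) (@times_realC R) (@times_1real R) (@times_realDl R)
    (@exp_real1_neq R).
HB.instance Definition _ (R : realType) :=
  GRing.ComNzRing_isField.Build (epos R) (@times_Vreal R) (@inv_real1 R).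

Section ExpComplex.
Variable R : realType.
Implicit Types (z : R[i]) (u v w : epolar R).

Lemma epolarP u : 0 < (epolar_val u).1. Proof. by case: u. Qed.

Definition exp_cplx z : epolar R :=
  @Epolar R (expR (complex.Re z), complex.Im z) (expR_gt0 _).
Definition log_cplx u : R[i] := Complex (ln (epolar_val u).1) (epolar_val u).2.
Definition one_cplx : epolar R := @Epolar R (1, 0) ltr01.
Definition mul_cplx u v : epolar R :=
  @Epolar R ((epolar_val u).1 * (epolar_val v).1,
             (epolar_val u).2 + (epolar_val v).2)
          (mulr_gt0 (epolarP u) (epolarP v)).
Definition times_cplx u v : epolar R := exp_cplx (log_cplx u * log_cplx v).
Definition opp_cplx u : epolar R := exp_cplx (- log_cplx u).
Definition inv_cplx u : epolar R := exp_cplx (log_cplx u)^-1.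

Lemma exp_cplxK : cancel exp_cplx log_cplx.
Proof. by case=> a b; rewrite /log_cplx /= expRK. Qed.

Lemma log_cplxK : cancel log_cplx exp_cplx.
Proof.
move=> u; apply: val_inj => /=; rewrite lnK ?posrE ?epolarP //.
by rewrite -surjective_pairing.
Qed.

Lemma log_cplx1 : log_cplx one_cplx = 0.
Proof. by rewrite /log_cplx /= ln1. Qed.

Lemma log_cplxM u v : log_cplx (mul_cplx u v) = log_cplx u + log_cplx v.
Proof. by rewrite /log_cplx /= lnM // posrE epolarP. Qed.

Let logE := (log_cplxM, log_cplx1, exp_cplxK).

Fact mul_cplxA : associative mul_cplx.
Proof. by move=> u v w; apply: (can_inj log_cplxK); rewrite !logE addrA. Qed.
Fact mul_cplxC : commutative mul_cplx.
Proof. by move=> u v; apply: (can_inj log_cplxK); rewrite !logE addrC. Qed.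
Fact mul_1cplx : left_id one_cplx mul_cplx.
Proof. by move=> u; apply: (can_inj log_cplxK); rewrite !logE add0r. Qed.
Fact mul_Vcplx : left_inverse one_cplx opp_cplx mul_cplx.
Proof. by move=> u; apply: (can_inj log_cplxK); rewrite !logE addNr. Qed.

Fact times_cplxA : associative times_cplx.
Proof. by move=> u v w; rewrite /times_cplx !logE mulrA. Qed.
Fact times_cplxC : commutative times_cplx.
Proof. by move=> u v; rewrite /times_cplx mulrC. Qed.
Fact times_1cplx : left_id (exp_cplx 1) times_cplx.
Proof. by move=> u; rewrite /times_cplx !logE mul1r log_cplxK. Qed.
Fact times_cplxDl : left_distributive times_cplx mul_cplx.
Proof.
by move=> u v w; apply: (can_inj log_cplxK); rewrite !logE mulrDl.
Qed.
Fact exp_cplx1_neq : exp_cplx 1 != one_cplx.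
Proof.
apply/eqP => /(congr1 log_cplx); rewrite !logE => /eqP.
by rewrite oner_eq0.
Qed.
Fact times_Vcplx u : u != one_cplx -> times_cplx (inv_cplx u) u = exp_cplx 1.
Proof.
move=> u1; rewrite /times_cplx !logE mulVf //.
by apply: contra u1 => /eqP lu; rewrite -(log_cplxK u) lu -log_cplx1 log_cplxK.
Qed.
Fact inv_cplx1 : inv_cplx one_cplx = one_cplx.
Proof. by apply: (can_inj log_cplxK); rewrite !logE invr0. Qed.

End ExpComplex.

(* The field e^C, with the same conventions: "+" is the product
   (r1 r2, theta1 + theta2), and "*" is exp (log a * log b). *)
HB.instance Definition _ (R : realType) := GRing.isZmodule.Build (epolar R)
  (@mul_cplxA R) (@mul_cplxC R) (@mul_1cplx R) (@mul_Vcplx R).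
HB.instance Definition _ (R : realType) :=
  GRing.Zmodule_isComNzRing.Build (epolar R)
    (@times_cplxA R) (@times_cplxC R) (@times_1cplx R) (@times_cplxDl R)
    (@exp_cplx1_neq R).
HB.instance Definition _ (R : realType) :=
  GRing.ComNzRing_isField.Build (epolar R) (@times_Vcplx R) (@inv_cplx1 R).

Variant scalar_kind := RealScalars | ComplexScalars.

Definition scalars (R : realType) (k : scalar_kind) : numFieldType :=
  match k with RealScalars => R | ComplexScalars => R[i] end.

Definition escalars (R : realType) (k : scalar_kind) : fieldType :=
  match k with RealScalars => epos R | ComplexScalars => epolar R end.

Definition expK (R : realType) (k : scalar_kind) :
    scalars R k -> escalars R k :=
  match k with
  | RealScalars => @exp_real R
  | ComplexScalars => @exp_cplx R
  end.

Definition logK (R : realType) (k : scalar_kind) :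
    escalars R k -> scalars R k :=
  match k with
  | RealScalars => @log_real R
  | ComplexScalars => @log_cplx R
  end.

Definition emul (R : realType) (k : scalar_kind) :
    escalars R k -> escalars R k -> escalars R k :=
  match k with
  | RealScalars => @mul_real R
  | ComplexScalars => @mul_cplx R
  end.

Definition eone (R : realType) (k : scalar_kind) : escalars R k :=
  match k with RealScalars => one_real R | ComplexScalars => one_cplx R end.

(* The inclusion of e^K in e^C, where a positive real r is identified with
   (r, 0). *)
Definition epolar_of (R : realType) (k : scalar_kind) :
    escalars R k -> epolar R :=
  match k with
  | RealScalars => fun u => @Epolar R (epos_val u, 0) (eposP u)
  | ComplexScalars => id
  end.

Section ExpScalars.
Variables (R : realType) (k : scalar_kind).
Implicit Types (z w : escalars R k).

Definition epow z (a : scalars R k) : escalars R k := expK (a * logK z).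

Definition in_eR z : Prop := (epolar_val (epolar_of z)).2 = 0.

(* Comparison of first components; this is the usual order when z and w both
   lie in e^R, the only case in which it is used. *)
Definition ele z w : Prop :=
  (epolar_val (epolar_of z)).1 <= (epolar_val (epolar_of w)).1.

Lemma eaddE z w : z + w = emul z w.
Proof. by case: k z w. Qed.

Lemma ezeroE : 0 = eone R k.
Proof. by case: k. Qed.

Lemma etimesE z w : z * w = expK (logK z * logK w).
Proof. by case: k z w. Qed.

Lemma etimes_epow z w : z * w = epow z (logK w).
Proof. by rewrite etimesE /epow mulrC. Qed.

End ExpScalars.

(* Vectors of (e^K)^n. The MathComp lmodType structure of 'rV over the field
   e^K is the one with vector addition u_i v_i and scalar multiplication
   u_i^(log a); see evaddE and evscaleE. *)
Section ExpVectors.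
Variables (R : realType) (k : scalar_kind) (n : nat).
Implicit Types (u v : 'rV[escalars R k]_n).

Definition evmul u v : 'rV[escalars R k]_n := \row_i emul (u 0 i) (v 0 i).

Definition evpow u (a : scalars R k) : 'rV[escalars R k]_n :=
  \row_i epow (u 0 i) a.

Lemma evaddE u v : u + v = evmul u v.
Proof. by apply/rowP => i; rewrite !mxE eaddE. Qed.

Lemma evscaleE (a : escalars R k) u : a *: u = evpow u (logK a).
Proof. by apply/rowP => i; rewrite !mxE etimesE. Qed.

Record multiplicative_norm (nu : 'rV[escalars R k]_n -> escalars R k) : Prop :=
  MultiplicativeNorm {
    mnorm_eR : forall u, in_eR (nu u);
    mnorm_ge1 : forall u, ele (eone R k) (nu u);
    mnorm_eq1 : forall u, nu u = eone R k <-> u = const_mx (eone R k);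
    mnorm_pow : forall u (a : scalars R k),
      nu (evpow u a) = epow (nu u) `|a|;
    mnorm_mul : forall u v, ele (nu (evmul u v)) (emul (nu u) (nu v))
  }.

End ExpVectors.

Section ExpSpace.
Variables (R : realType) (k : scalar_kind) (X : finNormedModType (scalars R k)).
Variable (b : (\dim {:X}).-tuple X).

(* e^X, in the coordinates given by the basis b of X. *)
Definition eX := 'rV[escalars R k]_(\dim {:X}).

Definition expX (x : X) : eX := \row_i expK (coord b i x).

Definition logX (u : eX) : X := \sum_i logK (u 0 i) *: b`_i.

Definition star_norm (u : eX) : escalars R k := expK `|logX u|.

End ExpSpace.

Definition arithmetic_generated (K L : fieldType) (alpha : K -> L) : Prop :=
  exists beta : L -> K,
    [/\ cancel alpha beta, cancel beta alpha,
        forall c d : L, c + d = alpha (beta c + beta d)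
      & forall c d : L, c * d = alpha (beta c * beta d)].

Record isometric_isomorphism (K L : fieldType) (alpha : K -> L)
    (X : lmodType K) (Y : lmodType L) (normX : X -> K) (normY : Y -> L)
    (phi : X -> Y) : Prop := IsometricIsomorphism {
  iso_arith : arithmetic_generated alpha;
  iso_bij : bijective phi;
  iso_add : forall x y, phi (x + y) = phi x + phi y;
  iso_scale : forall (a : K) x, phi (a *: x) = alpha a *: phi x;
  iso_norm : forall x, alpha (normX x) = normY (phi x)
}.

(* Main.v *)
Require Import Defs.
From HB Require Import structures.
From mathcomp Require Import all_boot all_order all_algebra.
From mathcomp Require Import complex.
From mathcomp Require Import all_classical all_reals all_analysis.
Set Implicit Arguments.
Unset Strict Implicit.
Unset Printing Implicit Defensive.
Import Order.TTheory GRing.Theory Num.Theory.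
Import numFieldNormedType.Exports.
Local Open Scope ring_scope.

(** The arithmetic of e^K and of e^X is that of K and X carried along exp: log turns products into
    sums and powers into scalar multiples. Hence [logX] is linear ([logX_evmul], [logX_evpow]), and
    each axiom of a multiplicative norm for [star_norm] is exp applied to the matching norm axiom of
    X. What remains is that exp and log are mutually inverse on vectors ([expXK], [logXK]), and that
    exp sends nonnegative scalars into e^R and preserves order ([in_eR_expK], [ele_expK]). *)

Section Scalars.
Variables (R : realType) (k : scalar_kind).
Implicit Types (z w : escalars R k) (a c : scalars R k).

Lemma expKK : cancel (@expK R k) (@logK R k).
Proof. by case: k; [exact: exp_realK | exact: exp_cplxK]. Qed.

Lemma logKK : cancel (@logK R k) (@expK R k).
Proof. by case: k; [exact: log_realK | exact: log_cplxK]. Qed.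

Lemma logKM z w : logK (emul z w) = logK z + logK w.
Proof. by case: k z w; [exact: log_realM | exact: log_cplxM]. Qed.

Lemma logK1 : logK (eone R k) = 0.
Proof. by case: k; [exact: log_real1 | exact: log_cplx1]. Qed.

Lemma expK0 : expK 0 = eone R k.
Proof. by rewrite -logK1 logKK. Qed.

Lemma expKD a c : expK (a + c) = emul (expK a) (expK c).
Proof. by apply: (can_inj logKK); rewrite logKM !expKK. Qed.

Lemma logK_epow z a : logK (epow z a) = a * logK z.
Proof. exact: expKK. Qed.

(** Norms on X take values in K itself. In the order of [R[i]], [0 <= a] forces the imaginary part
    of [a], which is the angle of [expK a], to vanish. *)
Lemma in_eR_expK a : 0 <= a -> in_eR (expK a).
Proof. by case: k a => // -[x y]; rewrite lecE => /andP[/eqP]. Qed.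

(** In [R[i]], [a <= c] includes the inequality of real parts, and the first component of exp is the
    increasing real exponential of the real part. *)
Lemma ele_expK a c : a <= c -> ele (expK a) (expK c).
Proof.
case: k a c => [a c|[x y] [x' y']]; rewrite /ele /=; first by rewrite ler_expR.
by rewrite lecE ler_expR => /andP[].
Qed.

Lemma expK_arithmetic : arithmetic_generated (@expK R k).
Proof.
exists (@logK R k); split; [exact: expKK | exact: logKK | |exact: etimesE].
by move=> z w; rewrite eaddE expKD !logKK.
Qed.

End Scalars.

Section Vectors.
Variables (R : realType) (k : scalar_kind) (X : finNormedModType (scalars R k)).
Variable (b : (\dim {:X}).-tuple X).
Implicit Types (x y : X) (u v : eX X) (a : scalars R k).

Lemma logX_evmul u v : logX b (evmul u v) = logX b u + logX b v.
Proof.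
by rewrite -big_split; apply: eq_bigr => i _; rewrite mxE logKM scalerDl.
Qed.

Lemma logX_evpow u a : logX b (evpow u a) = a *: logX b u.
Proof.
by rewrite scaler_sumr; apply: eq_bigr => i _; rewrite mxE logK_epow scalerA.
Qed.

Lemma expXD x y : expX b (x + y) = expX b x + expX b y.
Proof. by apply/rowP => i; rewrite !mxE linearD expKD eaddE. Qed.

Lemma expXZ a x : expX b (a *: x) = expK a *: expX b x.
Proof. by apply/rowP => i; rewrite !mxE linearZ etimesE !expKK. Qed.

Lemma expX0 : expX b 0 = const_mx (eone R k).
Proof. by apply/rowP => i; rewrite !mxE linear0 expK0. Qed.

Hypothesis hb : basis_of {:X} b.

(** Uses that [b] spans: [x] is recovered from its coordinates. *)
Lemma expXK : cancel (expX b) (logX b).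
Proof.
move=> x; rewrite {2}(coord_basis hb (memvf x)).
by apply: eq_bigr => i _; rewrite mxE expKK.
Qed.

(** Uses that [b] is free: the coordinates of a combination of [b] are its coefficients. *)
Lemma logXK : cancel (logX b) (expX b).
Proof.
move=> u; apply/rowP => i; rewrite mxE coord_sum_free ?logKK //.
exact: basis_free hb.
Qed.

Lemma star_norm_multiplicative : multiplicative_norm (star_norm b).
Proof.
split=> [u|u|u|u a|u v].
- exact/in_eR_expK/normr_ge0.
- by rewrite -expK0; exact/ele_expK/normr_ge0.
(* With both ones written as exponentials of 0, injectivity of exp reduces the claim to definiteness
   of the norm of X at [logX b u]. *)
- rewrite -expX0 -expK0; split=> [/(can_inj (@expKK R k))/eqP|->].
    by rewrite normr_eq0 => /eqP lu0; rewrite -(logXK u) lu0.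
  by rewrite /star_norm expXK normr0.
(* Homogeneity of the norm of X, read in the exponent. *)
- by rewrite /epow expKK /star_norm logX_evpow normrZ.
(* The triangle inequality in X, exponentiated. *)
- by rewrite -expKD /star_norm logX_evmul; exact/ele_expK/ler_normD.
Qed.

Lemma expX_isometric :
  isometric_isomorphism (@expK R k) (fun x : X => `|x|) (star_norm b) (expX b).
Proof.
split; [exact: expK_arithmetic | | exact: expXD | exact: expXZ |].
  by exists (logX b); [exact: expXK | exact: logXK].
by move=> x; rewrite /star_norm expXK.
Qed.

End Vectors.

Theorem theorem4 (R : realType) (k : scalar_kind)
    (X : finNormedModType (scalars R k)) (b : (\dim {:X}).-tuple X)
    (hb : basis_of {:X} b) :
  [/\ multiplicative_norm (star_norm b),
      isometric_isomorphism (@expK R k)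
        (fun x : X => `|x|) (star_norm b) (expX b),
      forall x : X, expK `|x| = star_norm b (expX b x)
    & forall v : eX X, logK (star_norm b v) = `|logX b v|].
Proof.
split; [exact: star_norm_multiplicative | exact: expX_isometric | |].
  by move=> x; rewrite /star_norm expXK.
by move=> v; exact: expKK.
Qed.
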